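(* Let $t\in\mathbb{C}$ and let $\mathcal{B}=\mathcal{Y}(\mathfrak g,\theta(\mathfrak g))\subset\mathcal{Y}(\mathfrak g)$, $\mathfrak g=\mathfrak{gl}(1|1)$, be the twisted Yangian of type I, i.e. the left coideal subalgebra generated by $H$, $H_2$ and $$\widetilde E^\pm=\widehat E^\pm\pm\alpha\,t\,E^\pm\mp\frac{\alpha}{2}HE^\pm.$$ Then $\mathcal{B}$ is a reflection algebra for the singlet boundary: the intertwining equation $$(T_{-u}\otimes\epsilon)[\Delta(b)]\,K(u)=K(u)\,(T_u\otimes\epsilon)[\Delta(b)]\qquad\text{for all }b\in\mathcal{B}$$ determines a nonzero $2\times2$ matrix $K(u)$ (with entries in $\mathbb{C}(u)$), uniquely up to an overall scalar factor, and this $K(u)$ satisfies the (graded) reflection equation $$R_{12}(u-v)\,K_1(u)\,R_{12}(u+v)\,K_2(v)=K_2(v)\,R_{12}(u+v)\,K_1(u)\,R_{12}(u-v)$$ on $\mathcal V\otimes\mathcal V$, $\mathcal V=\mathbb{C}^{1|1}$, $K_1=K\otimes1$, $K_2=1\otimes K$.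
   Context: $\mathcal{Y}(\mathfrak{gl}(1|1))$ is the Yangian (first realization, a Hopf superalgebra with graded tensor products) with formal deformation parameter $\alpha$, generated by odd $E^\pm,\widehat E^\pm$ and even $H,H_2,\widehat H,\widehat H_2$, with $\{E^+,E^-\}=H$, $\{E^\pm,\widehat E^\mp\}=\widehat H$, $(E^\pm)^2=0$, $\{E^\pm,\widehat E^\pm\}=0$, $H$ and $\widehat H$ central, $[H_2,E^\pm]=\pm2E^\pm$, $[H_2,\widehat E^\pm]=[\widehat H_2,E^\pm]=\pm2\widehat E^\pm$, $[H_2,\widehat H_2]=0$, together with the Yangian Serre-type relations. Coproduct: $\Delta(x)=x\otimes1+1\otimes x$ for $x\in\{E^\pm,H,H_2,\widehat H\}$, $\Delta(\widehat H_2)=\widehat H_2\otimes1+1\otimes\widehat H_2-\alpha(E^+\otimes E^-+E^-\otimes E^+)$, $\Delta(\widehat E^\pm)=\widehat E^\pm\otimes1+1\otimes\widehat E^\pm\mp\frac{\alpha}{2}(E^\pm\otimes H-H\otimes E^\pm)$; the counit $\epsilon$ vanishes on all these generators. Evaluation representation on $\mathcal V$ with basis $v_1$ (even), $v_2$ (odd): $T_u(E^+)=e_{1,2}$, $T_u(E^-)=e_{2,1}$, $T_u(H)=e_{1,1}+e_{2,2}$, $T_u(H_2)=e_{1,1}-e_{2,2}$, $T_u(\widehat X)=u\,T_u(X)$ for $X=E^\pm,H,H_2$, and $T_u(\alpha)=1$. $R$-matrix, as an (even) operator on $\mathcal V\otimes\mathcal V$ in the basis $v_1\otimes v_1,v_1\otimes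 v_2,v_2\otimes v_1,v_2\otimes v_2$: $$R(u)=\begin{pmatrix}1&0&0&0\\0&r&1-r&0\\0&1-r&r&0\\0&0&0&-1+2r\end{pmatrix},\qquad r=\frac{u}{u+1}.$$ All identities are identities of rational functions in $u,v$. *)

(* Defs.v *)
From HB Require Import structures.
From mathcomp Require Import all_boot all_order all_algebra.
From mathcomp Require Import boolp reals.
From mathcomp Require Import complex mxtens.

Set Implicit Arguments.
Unset Strict Implicit.
Unset Printing Implicit Defensive.

Import GRing.Theory Num.Theory.
Local Open Scope ring_scope.
Local Open Scope quotient_scope.

(* Associative unital algebras over A presented by generators and relations:  *)
(* noncommutative expressions modulo the congruence generated by the axioms   *)
(* of A-algebras and the given relations.                                     *)

Inductive expr (A G : Type) : Type :=
| Gen of G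
| Cst of A
| Add of expr A G & expr A G
| Mul of expr A G & expr A G.

Arguments Gen {A G} g.
Arguments Cst {A G} c.

Declare Scope expr_scope.
Delimit Scope expr_scope with X.
Bind Scope expr_scope with expr.
Infix "+" := Add : expr_scope.
Infix "*" := Mul : expr_scope.
Notation "x - y" := (x + Cst (-1)%R * y)%X : expr_scope.

HB.instance Definition _ (A G : Type) := gen_eqMixin (expr A G).
HB.instance Definition _ (A G : Type) := gen_choiceMixin (expr A G).

Fixpoint map_expr (A G G' : Type) (f : G -> G') (e : expr A G) : expr A G' :=
  match e with
  | Gen g => Gen (f g)
  | Cst c => Cst c
  | Add x y => Add (map_expr f x) (map_expr f y)
  | Mul x y => Mul (map_expr f x) (map_expr f y)
  end.

Section Presented.
Variables (A : comNzRingType) (G : Type).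
Variable rel : expr A G -> expr A G -> Prop.
Local Open Scope expr_scope.

Inductive cong : expr A G -> expr A G -> Prop :=
| cong_rel x y of rel x y : cong x y
| cong_refl x : cong x x
| cong_sym x y of cong x y : cong y x
| cong_trans x y z of cong x y & cong y z : cong x z
| cong_add x x' y y' of cong x x' & cong y y' : cong (x + y) (x' + y')
| cong_mul x x' y y' of cong x x' & cong y y' : cong (x * y) (x' * y')
| cong_addA x y z : cong (x + (y + z)) (x + y + z)
| cong_addC x y : cong (x + y) (y + x)
| cong_add0 x : cong (Cst 0 + x) x
| cong_addN x : cong (Cst (-1) * x + x) (Cst 0)
| cong_mulA x y z : cong (x * (y * z)) (x * y * z)
| cong_mul1 x : cong (Cst 1 * x) x
| cong_mulDl x y z : cong ((x + y) * z) (x * z + y * z)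
| cong_mulDr x y z : cong (x * (y + z)) (x * y + x * z)
| cong_cstD a b : cong (Cst (a + b)%R) (Cst a + Cst b)
| cong_cstM a b : cong (Cst (a * b)%R) (Cst a * Cst b)
| cong_cstC a x : cong (Cst a * x) (x * Cst a).

Definition congb (x y : expr A G) : bool := `[< cong x y >].

Lemma congb_refl : reflexive congb.
Proof. by move=> x; apply/asboolP; exact: cong_refl. Qed.

Lemma congb_sym : symmetric congb.
Proof. by move=> x y; apply/asboolP/asboolP => ?; exact: cong_sym. Qed.

Lemma congb_trans : transitive congb.
Proof.
by move=> y x z /asboolP xy /asboolP yz; apply/asboolP; exact: cong_trans yz.
Qed.

Canonical congb_equiv := EquivRel congb congb_refl congb_sym congb_trans.

Definition presented := {eq_quot congb}.
HB.instance Definition _ := Choice.on presented.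
HB.instance Definition _ : EqQuotient _ congb presented :=
  EqQuotient.on presented.

Definition cls (e : expr A G) : presented := \pi_presented e.

Lemma clsP x y : cls x = cls y <-> cong x y.
Proof.
by split=> [/eqmodP/asboolP//|xy]; apply/eqmodP/asboolP.
Qed.

Lemma cls_repr x : cls (repr x) = x. Proof. exact: reprK. Qed.

Lemma presentedW (P : presented -> Prop) : (forall e, P (cls e)) -> forall x, P x.
Proof. by move=> H x; rewrite -(cls_repr x). Qed.

Definition padd (x y : presented) := cls (repr x + repr y).
Definition pmul (x y : presented) := cls (repr x * repr y).
Definition popp (x : presented) := cls (Cst (-1) * repr x).

Lemma cong_repr x : cong (repr (cls x)) x.
Proof. by apply/clsP; rewrite cls_repr. Qed.

Lemma paddE x y : padd (cls x) (cls y) = cls (x + y).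
Proof. by apply/clsP/cong_add; exact: cong_repr. Qed.

Lemma pmulE x y : pmul (cls x) (cls y) = cls (x * y).
Proof. by apply/clsP/cong_mul; exact: cong_repr. Qed.

Lemma poppE x : popp (cls x) = cls (Cst (-1) * x).
Proof. by apply/clsP/cong_mul; [exact: cong_refl|exact: cong_repr]. Qed.

Let pE := (paddE, pmulE, poppE).

Lemma paddA : associative padd.
Proof.
by elim/presentedW=> x; elim/presentedW=> y; elim/presentedW=> z;
  rewrite !pE; apply/clsP/cong_addA.
Qed.
Lemma paddC : commutative padd.
Proof.
by elim/presentedW=> x; elim/presentedW=> y; rewrite !pE; apply/clsP/cong_addC.
Qed.
Lemma padd0 : left_id (cls (Cst 0)) padd.
Proof. by elim/presentedW=> x; rewrite !pE; apply/clsP/cong_add0. Qed.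
Lemma paddN : left_inverse (cls (Cst 0)) popp padd.
Proof. by elim/presentedW=> x; rewrite !pE; apply/clsP/cong_addN. Qed.

HB.instance Definition _ :=
  GRing.isZmodule.Build presented paddA paddC padd0 paddN.

Lemma pmulA : associative pmul.
Proof.
by elim/presentedW=> x; elim/presentedW=> y; elim/presentedW=> z;
  rewrite !pE; apply/clsP/cong_mulA.
Qed.
Lemma pmul1l : left_id (cls (Cst 1)) pmul.
Proof. by elim/presentedW=> x; rewrite !pE; apply/clsP/cong_mul1. Qed.
Lemma pmul1r : right_id (cls (Cst 1)) pmul.
Proof.
elim/presentedW=> x; rewrite !pE; apply/clsP.
exact: cong_trans (cong_sym (cong_cstC _ _)) (cong_mul1 _).
Qed.
Lemma pmulDl : left_distributive pmul padd.
Proof.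
by elim/presentedW=> x; elim/presentedW=> y; elim/presentedW=> z;
  rewrite !pE; apply/clsP/cong_mulDl.
Qed.
Lemma pmulDr : right_distributive pmul padd.
Proof.
by elim/presentedW=> x; elim/presentedW=> y; elim/presentedW=> z;
  rewrite !pE; apply/clsP/cong_mulDr.
Qed.

HB.instance Definition _ :=
  GRing.Zmodule_isPzRing.Build presented pmulA pmul1l pmul1r pmulDl pmulDr.

(* As the presented ring may be trivial it is not a MathComp lalgType; its    *)
(* A-algebra structure is the central ring morphism [cst].                    *)
Definition gen (g : G) : presented := cls (Gen g).
Definition cst (c : A) : presented := cls (Cst c).

Lemma clsD x y : cls (x + y) = (cls x + cls y)%R.
Proof. by rewrite -paddE. Qed.
Lemma clsM x y : cls (x * y) = (cls x * cls y)%R.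
Proof. by rewrite -pmulE. Qed.

Lemma cst_zmod : zmod_morphism cst.
Proof.
move=> a b; apply: (addIr (cst b)); rewrite subrK.
by rewrite /cst -clsD; apply/esym; rewrite -{1}(subrK b a); apply/clsP/cong_cstD.
Qed.
Lemma cst_monoid : monoid_morphism cst.
Proof. by split=> // a b; rewrite /cst -clsM; apply/clsP/cong_cstM. Qed.

HB.instance Definition _ := GRing.isZmodMorphism.Build A presented cst cst_zmod.
HB.instance Definition _ :=
  GRing.isMonoidMorphism.Build A presented cst cst_monoid.

Lemma cst_central a x : (cst a * x = x * cst a)%R.
Proof.
by elim/presentedW: x => x; rewrite /cst -!clsM; apply/clsP/cong_cstC.
Qed.

Lemma cls_relE x y : rel x y -> cls x = cls y.
Proof. by move=> xy; apply/clsP/cong_rel. Qed.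

Lemma presented_ind (P : presented -> Prop) :
  (forall g, P (gen g)) -> (forall c, P (cst c)) ->
  (forall x y, P x -> P y -> P (x + y)%R) ->
  (forall x y, P x -> P y -> P (x * y)%R) -> forall x, P x.
Proof.
move=> Pg Pc PD PM; elim/presentedW; elim=> [g|c|x Px y Py|x Px y Py].
- exact: Pg.
- exact: Pc.
- by rewrite clsD; exact: PD.
- by rewrite clsM; exact: PM.
Qed.

End Presented.

Section Lift.
Variables (A : comNzRingType) (G : Type) (D : pzRingType).
Variables (base : {rmorphism A -> D}) (f : G -> D).

Fixpoint evale (e : expr A G) : D :=
  match e with
  | Gen g => f g
  | Cst c => base c
  | Add x y => evale x + evale y
  | Mul x y => evale x * evale y
  end.

(* The algebra morphism sending each generator g to f g.  It is meaningful    *)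
(* when [base] commutes with f and f respects the relations, see [liftE].     *)
Definition lift (rel : expr A G -> expr A G -> Prop) (x : presented rel) : D :=
  evale (repr x).

Variable rel : expr A G -> expr A G -> Prop.
Hypothesis basefC : forall c g, base c * f g = f g * base c.
Hypothesis frel : forall x y, rel x y -> evale x = evale y.

Lemma evale_central c e : base c * evale e = evale e * base c.
Proof.
elim: e => [g|a|x IHx y IHy|x IHx y IHy] /=; first exact: basefC.
- by rewrite -!rmorphM mulrC.
- by rewrite mulrDl mulrDr IHx IHy.
- by rewrite mulrA IHx -mulrA IHy mulrA.
Qed.

Lemma evale_cong x y : cong rel x y -> evale x = evale y.
Proof.
elim=> //=; intros; try congruence.
- by rewrite addrA.
- by rewrite addrC.
- by rewrite rmorph0 add0r.
- by rewrite rmorphN1 mulN1r addNr rmorph0.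
- by rewrite mulrA.
- by rewrite rmorph1 mul1r.
- by rewrite mulrDl.
- by rewrite mulrDr.
- by rewrite rmorphD.
- by rewrite rmorphM.
- exact: evale_central.
Qed.

Lemma liftE e : lift (cls rel e) = evale e.
Proof. exact/evale_cong/cong_repr. Qed.

Lemma lift_gen g : lift (gen rel g) = f g. Proof. exact: liftE. Qed.
Lemma lift_cst c : lift (cst rel c) = base c. Proof. exact: liftE. Qed.

Lemma liftD : {morph @lift rel : x y / x + y}.
Proof.
elim/presentedW=> x; elim/presentedW=> y.
by rewrite -clsD !liftE.
Qed.

Lemma liftM : {morph @lift rel : x y / x * y}.
Proof.
elim/presentedW=> x; elim/presentedW=> y.
by rewrite -clsM !liftE.
Qed.

Lemma lift1 : lift (1 : presented rel) = 1.
Proof. by rewrite -(rmorph1 (cst rel)) lift_cst rmorph1. Qed.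
End Lift.

Section Brackets.
Variable D : pzRingType.
Implicit Types x y z : D.

Definition cm x y := x * y - y * x.
Definition ac x y := x * y + y * x.

Lemma cmDl x y z : cm (x + y) z = cm x z + cm y z.
Proof. by rewrite /cm mulrDl mulrDr opprD addrACA. Qed.
Lemma cmDr x y z : cm z (x + y) = cm z x + cm z y.
Proof. by rewrite /cm mulrDl mulrDr opprD addrACA. Qed.
Lemma cmNl x z : cm (- x) z = - cm x z.
Proof. by rewrite /cm mulNr mulrN opprD. Qed.
Lemma cmNr x z : cm z (- x) = - cm z x.
Proof. by rewrite /cm mulNr mulrN opprD. Qed.
Lemma acDl x y z : ac (x + y) z = ac x z + ac y z.
Proof. by rewrite /ac mulrDl mulrDr addrACA. Qed.
Lemma acDr x y z : ac z (x + y) = ac z x + ac z y.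
Proof. by rewrite /ac mulrDl mulrDr addrACA. Qed.
Lemma acNr x z : ac z (- x) = - ac z x.
Proof. by rewrite /ac mulNr mulrN opprD. Qed.
Lemma acC x y : ac x y = ac y x. Proof. by rewrite /ac addrC. Qed.

Lemma cmZr c x y : c * x = x * c -> cm x (c * y) = c * cm x y.
Proof. by move=> cx; rewrite /cm mulrA -cx mulrBr !mulrA. Qed.
Lemma cmZl c x y : c * x = x * c -> cm (c * y) x = c * cm y x.
Proof. by move=> cx; rewrite /cm mulrBr !mulrA -cx. Qed.
Lemma acZr c x y : c * x = x * c -> ac x (c * y) = c * ac x y.
Proof. by move=> cx; rewrite /ac mulrA -cx mulrDr !mulrA. Qed.
Lemma cmMr x y z : cm x (y * z) = cm x y * z + y * cm x z.
Proof. by rewrite /cm mulrBl mulrBr !mulrA addrA subrK. Qed.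
Lemma cmMl x y z : cm (y * z) x = y * ac z x - ac y x * z.
Proof.
by rewrite /cm /ac mulrDr mulrDl opprD !mulrA addrA addrK.
Qed.
Lemma cm0 x y : (cm x y = 0) <-> (x * y = y * x).
Proof. by rewrite /cm; split=> [/subr0_eq//|->]; rewrite subrr. Qed.
End Brackets.

(* In use, xl and xr stand for x (x) 1 and 1 (x) x. *)
Section DeltaComputations.
Variables (D : pzRingType) (el er kl kr : bool -> D).
Variables (hl hr hhl hhr wl wr h2l h2r a : D).
Variables (half two : bool -> D).
Definition cen (z : D) := forall x, z * x = x * z.
Hypotheses (hlC : cen hl) (hrC : cen hr) (aC : cen a).
Hypotheses (halfC : forall s, cen (half s)) (twoC : forall s, cen (two s)).
Hypothesis two_half : forall s, two s * half s = a.
Hypothesis halfN : forall s, half (~~ s) = - half s.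
Hypothesis twoN : forall s, two (~~ s) = - two s.
Hypothesis cross : forall s s', [/\ ac (el s) (er s') = 0, ac (el s) (kr s') = 0,
  ac (kl s) (er s') = 0 & ac (kl s) (kr s') = 0].
Hypothesis cross2 : forall s,
  [/\ cm h2l (er s) = 0, cm h2r (el s) = 0, cm h2l (kr s) = 0 & cm h2r (kl s) = 0].
Hypothesis cross3 : forall s,
  [/\ cm wl (er s) = 0, cm wr (el s) = 0, cm h2l wr = 0 & cm h2r wl = 0].
Hypothesis el2 : forall s, ac (el s) (el s) = 0.
Hypothesis er2 : forall s, ac (er s) (er s) = 0.
Hypothesis elN : forall s, ac (el s) (el (~~ s)) = hl.
Hypothesis erN : forall s, ac (er s) (er (~~ s)) = hr.
Hypothesis eklN : forall s, ac (el s) (kl (~~ s)) = hhl.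
Hypothesis ekrN : forall s, ac (er s) (kr (~~ s)) = hhr.
Hypothesis ekl : forall s, ac (el s) (kl s) = 0.
Hypothesis ekr : forall s, ac (er s) (kr s) = 0.
Hypothesis h2el : forall s, cm h2l (el s) = two s * el s.
Hypothesis h2er : forall s, cm h2r (er s) = two s * er s.
Hypothesis h2kl : forall s, cm h2l (kl s) = two s * kl s.
Hypothesis h2kr : forall s, cm h2r (kr s) = two s * kr s.
Hypothesis wel : forall s, cm wl (el s) = two s * kl s.
Hypothesis wer : forall s, cm wr (er s) = two s * kr s.
Hypothesis h2wl : cm h2l wl = 0.
Hypothesis h2wr : cm h2r wr = 0.

Let e s := el s + er s.
Let k s := kl s + kr s - half s * (el s * hr - hl * er s).
Let w := wl + wr - a * (el true * er false + el false * er true).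

Let acx0 s s' : ac (el s) (er s') = 0. Proof. by case: (cross s s'). Qed.
Let acx1 s s' : ac (el s) (kr s') = 0. Proof. by case: (cross s s'). Qed.
Let acx2 s s' : ac (er s) (kl s') = 0.
Proof. by rewrite acC; case: (cross s' s). Qed.
Let acx3 s s' : ac (er s) (el s') = 0. Proof. by rewrite acC acx0. Qed.

Lemma dEE s : ac (e s) (e (~~ s)) = hl + hr.
Proof. by rewrite /e acDl !acDr !acx0 !acx3 addr0 add0r elN erN. Qed.

Lemma dE2 s : e s * e s = el s * el s + er s * er s.
Proof.
by rewrite /e mulrDl !mulrDr -addrA [X in _ + X]addrA -/(ac _ _) acx0 add0r.
Qed.

Let ac_e_k s s' : ac (e s) (k s') =
  ac (el s) (kl s') + ac (er s) (kr s')
  - half s' * (hr * ac (el s) (el s') - hl * ac (er s) (er s')).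
Proof.
rewrite /e /k !acDl !acDr !acNr !acZr ?halfC // -!hrC.
rewrite !acDr !acNr !acZr ?hrC ?hlC // !acx0 !acx1 !acx2 !acx3.
by rewrite !mul0r addr0 add0r subr0 sub0r addrACA -opprD -mulrDl.
Qed.

Lemma dEEhN s : ac (e s) (k (~~ s)) = hhl + hhr.
Proof. by rewrite ac_e_k eklN ekrN elN erN hrC subrr mulr0 subr0. Qed.

Lemma dEEh s : ac (e s) (k s) = 0.
Proof. by rewrite ac_e_k ekl ekr el2 er2 !mulr0 subr0 addr0 mulr0 subr0. Qed.

Lemma dH2E s : cm (h2l + h2r) (e s) = two s * e s.
Proof.
case: (cross2 s) => a1 a2 _ _.
by rewrite /e cmDl !cmDr a1 a2 h2el h2er addr0 add0r mulrDr.
Qed.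

Lemma dH2Eh s : cm (h2l + h2r) (k s) = two s * k s.
Proof.
case: (cross2 s) => a1 a2 a3 a4.
have C1 : cm (h2l + h2r) (kl s) = two s * kl s by rewrite cmDl a4 addr0 h2kl.
have C2 : cm (h2l + h2r) (kr s) = two s * kr s by rewrite cmDl a3 add0r h2kr.
have C3 : cm (h2l + h2r) (el s) = two s * el s by rewrite cmDl a2 addr0 h2el.
have C4 : cm (h2l + h2r) (er s) = two s * er s by rewrite cmDl a1 add0r h2er.
rewrite /k !cmDr cmNr (cmZr _ (halfC s _)) cmDr cmNr -(hrC (el s)).
rewrite (cmZr _ (hrC _)) (cmZr _ (hlC _)).
rewrite C1 C2 C3 C4 [RHS]mulrBr [in RHS]mulrDr; congr (_ - _).
rewrite [RHS]mulrA [two s * half s]twoC -mulrA; congr (_ * _).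
by rewrite mulrBr !mulrA (hrC (two s)) (hlC (two s)).
Qed.

Lemma dH2hE s : cm w (e s) = two s * k s.
Proof.
have [a1 a2 _ _] := cross3 s.
have key s0 : cm (el s0 * er (~~ s0) + el (~~ s0) * er s0) (e s0)
    = el s0 * hr - hl * er s0.
  rewrite /e cmDl !cmDr !cmMl.
  rewrite !acx3 !acx0 el2 er2 (acC (er (~~ s0))) (acC (el (~~ s0))) elN erN.
  by rewrite !(mulr0, mul0r, oppr0, sub0r, addr0, add0r).
have key' : cm (el true * er false + el false * er true) (e s)
    = el s * hr - hl * er s.
  by rewrite -key; case: (s) => //=; rewrite addrC.
rewrite /w cmDl cmNl (cmZl _ (aC _)) key' cmDl [cm wl _]cmDr [cm wr _]cmDr wel wer a1 a2.
rewrite addr0 add0r /k [RHS]mulrBr [in RHS]mulrDr; congr (_ - _).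
by rewrite [RHS]mulrA two_half.
Qed.

Lemma dH2H2h : cm (h2l + h2r) w = 0.
Proof.
have [_ _ a1 a2] := cross3 true.
have key s : cm (h2l + h2r) (el s * er (~~ s)) = 0.
  have [b1 b2 _ _] := cross2 s; have [c1 c2 _ _] := cross2 (~~ s).
  rewrite cmMr !cmDl b2 c1 addr0 add0r h2el h2er twoN mulNr mulrN.
  by rewrite mulrA -twoC subrr.
rewrite /w !cmDr cmNr (cmZr _ (aC _)) cmDr (key true) (key false) addr0 mulr0 subr0.
by rewrite !cmDl h2wl h2wr a1 a2 !addr0.
Qed.
End DeltaComputations.

(* The boolean argument of E and Eh is the superscript (true for +, false for *)
(* -); a final h stands for the hat.                                          *)

Inductive ygen := E of bool | H | H2 | Eh of bool | Hh | H2h.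

Definition odd_gen (g : ygen) : bool :=
  match g with E _ | Eh _ => true | _ => false end.

Section Yangian.
Variable F : numFieldType.
(* The formal parameter alpha is 'X. *)
Local Notation A := {poly F}.

Definition yexpr := expr A ygen.

Definition pm (s : bool) (c : F) : F := if s then c else - c.

Section Relations.
(* [serre] is the set of Serre-type relations, imposed on top of the explicit *)
(* ones below.  It is a parameter, constrained only by [serre_compatible]:    *)
(* coproduct, counit and evaluation representation must respect it.           *)
Variable serre : yexpr -> yexpr -> Prop.

Local Notation X := (@Gen A ygen).
Local Notation "c %:K" := (@Cst A ygen c%:P) (at level 2, format "c %:K").
Local Notation "{, x , y }" := (x * y + y * x)%X (at level 0).
Local Notation "[, x , y ]" := (x * y - y * x)%X (at level 0).

Inductive yangian_rel : yexpr -> yexpr -> Prop :=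
| rel_EE : yangian_rel {, X (E true), X (E false)} (X H)
| rel_EEh s : yangian_rel {, X (E s), X (Eh (~~ s))} (X Hh)
| rel_E2 s : yangian_rel (X (E s) * X (E s))%X 0%:K
| rel_EEh0 s : yangian_rel {, X (E s), X (Eh s)} 0%:K
| rel_H g : yangian_rel [, X H, X g] 0%:K
| rel_Hh g : yangian_rel [, X Hh, X g] 0%:K
| rel_H2E s : yangian_rel [, X H2, X (E s)] ((pm s 2%:R)%:K * X (E s))%X
| rel_H2Eh s : yangian_rel [, X H2, X (Eh s)] ((pm s 2%:R)%:K * X (Eh s))%X
| rel_H2hE s : yangian_rel [, X H2h, X (E s)] ((pm s 2%:R)%:K * X (Eh s))%X
| rel_H2H2h : yangian_rel [, X H2, X H2h] 0%:K
| rel_serre x y of serre x y : yangian_rel x y.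

Definition yangian := presented yangian_rel.
Definition Y (g : ygen) : yangian := gen _ g.

(* Graded tensor square: two copies of the generators (inl g is g (x) 1 and   *)
(* inr g is 1 (x) g), the relations in each copy, and the sign rule           *)
(* (1 (x) h) (g (x) 1) = (-1)^(|g| |h|) g (x) h.                              *)
Inductive tensor_rel :
    expr A (ygen + ygen) -> expr A (ygen + ygen) -> Prop :=
| rel_l x y of yangian_rel x y : tensor_rel (map_expr inl x) (map_expr inl y)
| rel_r x y of yangian_rel x y : tensor_rel (map_expr inr x) (map_expr inr y)
| rel_lr g h : tensor_rel (Gen (inr h) * Gen (inl g))%X
    (Cst ((-1) ^+ (odd_gen g && odd_gen h)) * (Gen (inl g) * Gen (inr h)))%X.

Definition tensor2 := presented tensor_rel.

Definition tl : yangian -> tensor2 :=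
  @lift A ygen tensor2 (cst tensor_rel) (fun g => gen tensor_rel (inl g)) _.
Definition tr : yangian -> tensor2 :=
  @lift A ygen tensor2 (cst tensor_rel) (fun g => gen tensor_rel (inr g)) _.
Definition tens (x y : yangian) : tensor2 := tl x * tr y.

Local Notation "x ⊗ y" := (tens x y) (at level 40).

Definition alpha : tensor2 := cst _ 'X.

Definition Delta_gen (g : ygen) : tensor2 :=
  match g with
  | H2h => Y H2h ⊗ 1 + 1 ⊗ Y H2h
             - alpha * (Y (E true) ⊗ Y (E false) + Y (E false) ⊗ Y (E true))
  | Eh s => Y (Eh s) ⊗ 1 + 1 ⊗ Y (Eh s)
             - cst _ (pm s 2%:R^-1 *: 'X)
               * (Y (E s) ⊗ Y H - Y H ⊗ Y (E s))
  | _ => Y g ⊗ 1 + 1 ⊗ Y g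
  end.

Definition Delta : yangian -> tensor2 :=
  @lift A ygen tensor2 (cst tensor_rel) Delta_gen _.

Definition eps_gen (g : ygen) : A := 0.
Definition eps : yangian -> A := @lift A ygen A idfun eps_gen _.

Local Notation "x %:F" := (@FracField.tofrac _ x).

Definition ratf := {fraction {poly F}}.
Definition upar : ratf := 'X%:F.

(* Scalars act through alpha |-> 1. *)
Definition spec1 : A -> 'M[ratf]_2 :=
  scalar_mx \o @FracField.tofrac {poly F} \o polyC \o horner_eval 1.
HB.instance Definition _ := GRing.RMorphism.on spec1.

Definition T_gen (x : ratf) (g : ygen) : 'M[ratf]_2 :=
  let TE (s : bool) := if s then delta_mx 0 1 else delta_mx 1 0 in
  let TH2 := delta_mx 0 0 - delta_mx 1 1 in
  match g with
  | E s => TE s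
  | H => 1%:M
  | H2 => TH2
  | Eh s => x *: TE s
  | Hh => x%:M
  | H2h => x *: TH2
  end.
(* The evaluation representation at spectral parameter x: T_u is [T upar] and *)
(* T_(-u) is [T (- upar)].                                                    *)
Definition T (x : ratf) : yangian -> 'M[ratf]_2 :=
  @lift A ygen _ spec1 (T_gen x) _.

(* T_x (x) eps, see [T_eps_tens]; a scalar eps(y) acts on V through [spec1]. *)
Definition T_eps_gen (x : ratf) (g : ygen + ygen) : 'M[ratf]_2 :=
  match g with inl g => T_gen x g | inr g => spec1 (eps_gen g) end.
Definition T_eps (x : ratf) : tensor2 -> 'M[ratf]_2 :=
  @lift A _ _ spec1 (T_eps_gen x) _.

Record serre_compatible : Prop := SerreCompatible {
  serre_Delta x y : serre x y ->
    evale (cst tensor_rel) Delta_gen x = evale (cst tensor_rel) Delta_gen y;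
  serre_eps x y : serre x y ->
    evale (idfun : {rmorphism A -> A}) eps_gen x =
    evale (idfun : {rmorphism A -> A}) eps_gen y;
  serre_T z x y : serre x y ->
    evale spec1 (T_gen z) x = evale spec1 (T_gen z) y
}.

Inductive subalgebra (P : yangian -> Prop) : yangian -> Prop :=
| sub_gen x of P x : subalgebra P x
| sub_cst c : subalgebra P (cst _ c)
| sub_add x y of subalgebra P x & subalgebra P y : subalgebra P (x + y)
| sub_mul x y of subalgebra P x & subalgebra P y : subalgebra P (x * y).

(* \widetilde E^s *)
Definition Et (t : F) (s : bool) : yangian :=
  Y (Eh s) + cst _ (pm s t *: 'X) * Y (E s)
  - cst _ (pm s 2%:R^-1 *: 'X) * (Y H * Y (E s)).

Definition twisted_yangian (t : F) : yangian -> Prop :=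
  subalgebra (fun b => [\/ b = Y H, b = Y H2 | exists s, b = Et t s]).

Definition intertwines (t : F) (K : 'M[ratf]_2) : Prop :=
  forall b, twisted_yangian t b ->
    T_eps (- upar) (Delta b) *m K = K *m T_eps upar (Delta b).

(* The span of the x (x) y with x in P and y in Q.  It is an F[alpha]-module  *)
(* as soon as P or Q is stable under scalars.                                 *)
Inductive tens_span (P Q : yangian -> Prop) : tensor2 -> Prop :=
| span_tens x y of P x & Q y : tens_span P Q (x ⊗ y)
| span_add a b of tens_span P Q a & tens_span P Q b : tens_span P Q (a + b).

Local Notation tcst := (cst tensor_rel).
Local Notation gl g := (gen tensor_rel (inl g)).
Local Notation gr g := (gen tensor_rel (inr g)).

Lemma evale_map (G G' : Type) (r : expr A G' -> expr A G' -> Prop)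
    (i : G -> G') x :
  evale (cst r) (fun g => gen r (i g)) x = cls r (map_expr i x).
Proof. by elim: x => //= x -> y ->; rewrite ?clsD ?clsM. Qed.

Let tlC c g : tcst c * gl g = gl g * tcst c. Proof. exact: cst_central. Qed.
Let trC c g : tcst c * gr g = gr g * tcst c. Proof. exact: cst_central. Qed.

Lemma tl_rel x y : yangian_rel x y ->
  evale tcst (fun g => gl g) x = evale tcst (fun g => gl g) y.
Proof. by move=> xy; rewrite !evale_map; apply/cls_relE/rel_l. Qed.
Lemma tr_rel x y : yangian_rel x y ->
  evale tcst (fun g => gr g) x = evale tcst (fun g => gr g) y.
Proof. by move=> xy; rewrite !evale_map; apply/cls_relE/rel_r. Qed.

Lemma tl_gen g : tl (Y g) = gl g. Proof. exact: (lift_gen tlC tl_rel). Qed.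
Lemma tr_gen g : tr (Y g) = gr g. Proof. exact: (lift_gen trC tr_rel). Qed.
Lemma tl_cst c : tl (cst _ c) = tcst c. Proof. exact: (lift_cst tlC tl_rel). Qed.
Lemma tr_cst c : tr (cst _ c) = tcst c. Proof. exact: (lift_cst trC tr_rel). Qed.
Lemma tlD : {morph tl : x y / x + y}. Proof. exact: (liftD tlC tl_rel). Qed.
Lemma trD : {morph tr : x y / x + y}. Proof. exact: (liftD trC tr_rel). Qed.
Lemma tlM : {morph tl : x y / x * y}. Proof. exact: (liftM tlC tl_rel). Qed.
Lemma trM : {morph tr : x y / x * y}. Proof. exact: (liftM trC tr_rel). Qed.
Lemma tl1 : tl 1 = 1. Proof. exact: (lift1 tlC tl_rel). Qed.
Lemma tr1 : tr 1 = 1. Proof. exact: (lift1 trC tr_rel). Qed.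

Lemma tens_gen g h : Y g ⊗ Y h = gl g * gr h.
Proof. by rewrite /tens tl_gen tr_gen. Qed.
Lemma tensg1 g : Y g ⊗ 1 = gl g.
Proof. by rewrite /tens tl_gen tr1 mulr1. Qed.
Lemma tens1g g : 1 ⊗ Y g = gr g.
Proof. by rewrite /tens tr_gen tl1 mul1r. Qed.

Lemma gr_gl g h :
  gr h * gl g = (-1) ^+ (odd_gen g && odd_gen h) * (gl g * gr h).
Proof.
rewrite -(rmorphN1 tcst) -rmorphXn /cst /gen -!clsM.
exact/cls_relE/rel_lr.
Qed.

Let eq_l x y : yangian_rel x y -> cls tensor_rel (map_expr inl x) =
  cls tensor_rel (map_expr inl y).
Proof. by move=> /rel_l; apply: cls_relE. Qed.
Let eq_r x y : yangian_rel x y -> cls tensor_rel (map_expr inr x) =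
  cls tensor_rel (map_expr inr y).
Proof. by move=> /rel_r; apply: cls_relE. Qed.

Let ac0 g h : odd_gen g -> odd_gen h -> ac (gl g) (gr h) = 0.
Proof.
by move=> og oh; rewrite /ac gr_gl og oh expr1 mulN1r subrr.
Qed.
Let cmx g h : odd_gen g && odd_gen h = false -> cm (gl g) (gr h) = 0.
Proof. by move=> o; rewrite /cm gr_gl o expr0 mul1r subrr. Qed.
Let cmx' g h : odd_gen g && odd_gen h = false -> cm (gr h) (gl g) = 0.
Proof. by move=> o; rewrite /cm gr_gl o expr0 mul1r subrr. Qed.

Let central_gen z : (forall g, z * gl g = gl g * z) ->
  (forall g, z * gr g = gr g * z) -> cen z.
Proof.
move=> zl zr x; elim/presented_ind: x => [[g|g]|c|x y Hx Hy|x y Hx Hy] //.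
- by rewrite cst_central.
- by rewrite mulrDl mulrDr Hx Hy.
- by rewrite mulrA Hx -mulrA Hy mulrA.
Qed.

Let cls_cm (r : expr A (ygen + ygen) -> expr A (ygen + ygen) -> Prop) x y :
  cls r (x - y)%X = cls r x - cls r y.
Proof. by rewrite clsD clsM -/(cst r _) rmorphN1 mulN1r. Qed.

Let relE := (cls_cm, @clsD, @clsM).

Let glH : cen (gl H).
Proof.
apply: central_gen => g; last by apply/cm0/cmx.
by apply/cm0; move: (eq_l (rel_H g)); rewrite /= !relE -/(cst _ _) !rmorph0.
Qed.
Let glHh : cen (gl Hh).
Proof.
apply: central_gen => g; last by apply/cm0/cmx.
by apply/cm0; move: (eq_l (rel_Hh g)); rewrite /= !relE -/(cst _ _) !rmorph0.
Qed.
Let grH : cen (gr H).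
Proof.
apply: central_gen => g; first by apply/cm0/cmx'; rewrite andbF.
by apply/cm0; move: (eq_r (rel_H g)); rewrite /= !relE -/(cst _ _) !rmorph0.
Qed.
Let grHh : cen (gr Hh).
Proof.
apply: central_gen => g; first by apply/cm0/cmx'; rewrite andbF.
by apply/cm0; move: (eq_r (rel_Hh g)); rewrite /= !relE -/(cst _ _) !rmorph0.
Qed.

Let two s := tcst (pm s 2%:R)%:P.
Let half s := tcst (pm s 2%:R^-1 *: 'X).

Let pmN s c : pm (~~ s) c = - pm s c.
Proof. by case: s => //=; rewrite opprK. Qed.

Lemma Delta_rel x y : serre_compatible -> yangian_rel x y ->
  evale tcst Delta_gen x = evale tcst Delta_gen y.
Proof.
move=> Sc.
have two_half s : two s * half s = alpha.
  rewrite -rmorphM mul_polyC scalerA; congr (tcst _).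
  have -> : pm s 2%:R * pm s 2%:R^-1 = 1 :> F.
    by case: s; rewrite /= ?mulrNN mulfV // pnatr_eq0.
  by rewrite scale1r.
have halfN s : half (~~ s) = - half s.
  by rewrite /half pmN scaleNr rmorphN.
have twoN s : two (~~ s) = - two s by rewrite /two pmN polyCN rmorphN.
have cC c : cen (tcst c) by move=> z; exact: cst_central.
have E2l s : gl (E s) * gl (E s) = 0.
  by move: (eq_l (rel_E2 s)); rewrite /= !relE -/(cst _ _) !rmorph0.
have E2r s : gr (E s) * gr (E s) = 0.
  by move: (eq_r (rel_E2 s)); rewrite /= !relE -/(cst _ _) !rmorph0.
have el2 s : ac (gl (E s)) (gl (E s)) = 0 by rewrite /ac E2l addr0.
have er2 s : ac (gr (E s)) (gr (E s)) = 0 by rewrite /ac E2r addr0.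
have elN s : ac (gl (E s)) (gl (E (~~ s))) = gl H.
  have h : ac (gl (E true)) (gl (E false)) = gl H.
    by move: (eq_l rel_EE); rewrite /= !relE.
  by case: s => //=; rewrite acC.
have erN s : ac (gr (E s)) (gr (E (~~ s))) = gr H.
  have h : ac (gr (E true)) (gr (E false)) = gr H.
    by move: (eq_r rel_EE); rewrite /= !relE.
  by case: s => //=; rewrite acC.
have eklN s : ac (gl (E s)) (gl (Eh (~~ s))) = gl Hh.
  by move: (eq_l (rel_EEh s)); rewrite /= !relE.
have ekrN s : ac (gr (E s)) (gr (Eh (~~ s))) = gr Hh.
  by move: (eq_r (rel_EEh s)); rewrite /= !relE.
have ekl s : ac (gl (E s)) (gl (Eh s)) = 0.
  by move: (eq_l (rel_EEh0 s)); rewrite /= !relE -/(cst _ _) !rmorph0.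
have ekr s : ac (gr (E s)) (gr (Eh s)) = 0.
  by move: (eq_r (rel_EEh0 s)); rewrite /= !relE -/(cst _ _) !rmorph0.
have h2el s : cm (gl H2) (gl (E s)) = two s * gl (E s).
  by move: (eq_l (rel_H2E s)); rewrite /= !relE.
have h2er s : cm (gr H2) (gr (E s)) = two s * gr (E s).
  by move: (eq_r (rel_H2E s)); rewrite /= !relE.
have h2kl s : cm (gl H2) (gl (Eh s)) = two s * gl (Eh s).
  by move: (eq_l (rel_H2Eh s)); rewrite /= !relE.
have h2kr s : cm (gr H2) (gr (Eh s)) = two s * gr (Eh s).
  by move: (eq_r (rel_H2Eh s)); rewrite /= !relE.
have wel s : cm (gl H2h) (gl (E s)) = two s * gl (Eh s).
  by move: (eq_l (rel_H2hE s)); rewrite /= !relE.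
have wer s : cm (gr H2h) (gr (E s)) = two s * gr (Eh s).
  by move: (eq_r (rel_H2hE s)); rewrite /= !relE.
have h2wl : cm (gl H2) (gl H2h) = 0.
  by move: (eq_l rel_H2H2h); rewrite /= !relE -/(cst _ _) !rmorph0.
have h2wr : cm (gr H2) (gr H2h) = 0.
  by move: (eq_r rel_H2H2h); rewrite /= !relE -/(cst _ _) !rmorph0.
have evcm u v : evale tcst Delta_gen (u * v - v * u)%X =
    cm (evale tcst Delta_gen u) (evale tcst Delta_gen v).
  by rewrite /= rmorphN1 mulN1r.
have cross s s' : [/\ ac (gl (E s)) (gr (E s')) = 0,
    ac (gl (E s)) (gr (Eh s')) = 0, ac (gl (Eh s)) (gr (E s')) = 0
    & ac (gl (Eh s)) (gr (Eh s')) = 0] by split; apply: ac0.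
have cross2 s : [/\ cm (gl H2) (gr (E s)) = 0, cm (gr H2) (gl (E s)) = 0,
    cm (gl H2) (gr (Eh s)) = 0 & cm (gr H2) (gl (Eh s)) = 0].
  by split; rewrite ?cmx ?cmx'.
have cross3 s : [/\ cm (gl H2h) (gr (E s)) = 0, cm (gr H2h) (gl (E s)) = 0,
    cm (gl H2) (gr H2h) = 0 & cm (gr H2) (gl H2h) = 0].
  by split; rewrite ?cmx ?cmx'.
have DE : forall s, Delta_gen (E s) = gl (E s) + gr (E s).
  by move=> s; rewrite /= tensg1 tens1g.
have DH : Delta_gen H = gl H + gr H by rewrite /= tensg1 tens1g.
have DHh : Delta_gen Hh = gl Hh + gr Hh by rewrite /= tensg1 tens1g.
have DH2 : Delta_gen H2 = gl H2 + gr H2 by rewrite /= tensg1 tens1g.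
have DEh s : Delta_gen (Eh s) = gl (Eh s) + gr (Eh s)
    - half s * (gl (E s) * gr H - gl H * gr (E s)).
  by rewrite /Delta_gen tensg1 tens1g !tens_gen.
have DH2h : Delta_gen H2h = gl H2h + gr H2h
    - alpha * (gl (E true) * gr (E false) + gl (E false) * gr (E true)).
  by rewrite /Delta_gen tensg1 tens1g !tens_gen.
pose el s := gl (E s); pose er s := gr (E s).
pose Dg := Delta_gen; pose ev := evale tcst Delta_gen.
have cenD u v : cen u -> cen v -> cen (u + v).
  by move=> cu cv z; rewrite mulrDl mulrDr cu cv.
case=> [|s|s|s|g|g|s|s|s||{}x {}y Sxy].
- change (ac (Dg (E true)) (Dg (E false)) = Dg H); rewrite /Dg !DE DH.
  exact: (dEE (el := el) (er := er) cross elN erN true).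
- change (ac (Dg (E s)) (Dg (Eh (~~ s))) = Dg Hh); rewrite /Dg !DE DEh DHh.
  exact: (dEEhN (el := el) (er := er) glH grH (fun s => cC _) cross
    elN erN eklN ekrN s).
- change (Dg (E s) * Dg (E s) = tcst 0); rewrite /Dg !DE rmorph0.
  by rewrite (dE2 (el := el) (er := er) cross) E2l E2r addr0.
- change (ac (Dg (E s)) (Dg (Eh s)) = tcst 0); rewrite /Dg !DE DEh rmorph0.
  exact: (dEEh (el := el) (er := er) glH grH (fun s => cC _) cross
    el2 er2 ekl ekr s).
- rewrite evcm [RHS]/= rmorph0; apply/cm0.
  by change (Dg H * Dg g = Dg g * Dg H); rewrite /Dg DH; apply: cenD.
- rewrite evcm [RHS]/= rmorph0; apply/cm0.
  by change (Dg Hh * Dg g = Dg g * Dg Hh); rewrite /Dg DHh; apply: cenD.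
- rewrite evcm; change (cm (Dg H2) (Dg (E s)) = two s * Dg (E s)).
  rewrite /Dg DH2 DE; exact: (dH2E (el := el) (er := er) cross2 h2el h2er s).
- rewrite evcm; change (cm (Dg H2) (Dg (Eh s)) = two s * Dg (Eh s)).
  rewrite /Dg DH2 DEh.
  exact: (dH2Eh (el := el) (er := er) glH grH (fun s => cC _) (fun s => cC _)
    cross2 h2el h2er h2kl h2kr s).
- rewrite evcm; change (cm (Dg H2h) (Dg (E s)) = two s * Dg (Eh s)).
  rewrite /Dg DH2h DEh DE.
  exact: (dH2hE (el := el) (er := er) (cC _) two_half cross cross3 el2 er2
    elN erN wel wer s).
- rewrite evcm; change (cm (Dg H2) (Dg H2h) = tcst 0).
  rewrite /Dg DH2 DH2h rmorph0.
  exact: (dH2H2h (el := el) (er := er) (cC _) (fun s => cC _) twoN cross2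
    cross3 h2el h2er h2wl h2wr).
- exact: (serre_Delta Sc Sxy).
Qed.

Section Compatible.
Hypothesis Sc : serre_compatible.

Let DC c g : tcst c * Delta_gen g = Delta_gen g * tcst c.
Proof. exact: cst_central. Qed.
Let DR x y (xy : yangian_rel x y) := Delta_rel Sc xy.

Lemma Delta_Y g : Delta (Y g) = Delta_gen g. Proof. exact: (lift_gen DC DR). Qed.
Lemma Delta_cst c : Delta (cst _ c) = tcst c. Proof. exact: (lift_cst DC DR). Qed.
Lemma DeltaD : {morph Delta : x y / x + y}. Proof. exact: (liftD DC DR). Qed.
Lemma DeltaM : {morph Delta : x y / x * y}. Proof. exact: (liftM DC DR). Qed.

Lemma eps_rel x y : yangian_rel x y ->
  evale (idfun : {rmorphism A -> A}) eps_gen x =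
  evale (idfun : {rmorphism A -> A}) eps_gen y.
Proof.
case=> [|s|s|s|g|g|s|s|s||{}x {}y Sxy];
  last exact: (serre_eps Sc Sxy); by rewrite /= /eps_gen !(mulr0, mul0r, addr0).
Qed.
Let eC c g : (idfun : {rmorphism A -> A}) c * eps_gen g =
  eps_gen g * (idfun : {rmorphism A -> A}) c.
Proof. exact: mulrC. Qed.

Lemma eps_Y g : eps (Y g) = 0. Proof. exact: (lift_gen eC eps_rel). Qed.
Lemma eps_cst c : eps (cst _ c) = c. Proof. exact: (lift_cst eC eps_rel). Qed.
Lemma epsD : {morph eps : x y / x + y}. Proof. exact: (liftD eC eps_rel). Qed.
Lemma epsM : {morph eps : x y / x * y}. Proof. exact: (liftM eC eps_rel). Qed.

Variable z : ratf.

Lemma spec1_polyC c : spec1 c%:P = (c%:P%:F)%:M.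
Proof. by rewrite /spec1 /= /horner_eval hornerC. Qed.

Let dd (i j k l : 'I_2) : (delta_mx i j : 'M[ratf]_2) * delta_mx k l
  = if j == k then delta_mx i l else 0.
Proof. by rewrite -mulmxE mul_delta_mx_cond mulrb. Qed.

Let TE s : 'M[ratf]_2 := if s then delta_mx 0 1 else delta_mx 1 0.
Let TH2 : 'M[ratf]_2 := delta_mx 0 0 - delta_mx 1 1.

Let TEE s : TE s * TE s = 0.
Proof. by case: s; rewrite /TE dd. Qed.
Let TEN s : TE s * TE (~~ s) + TE (~~ s) * TE s = 1.
Proof.
have D : delta_mx 0 0 + delta_mx 1 1 = 1 :> 'M[ratf]_2.
  rewrite (_ : 1 = 1%:M :> 'M_2) // scalar_mx_sum_delta.
  by rewrite big_ord_recl big_ord1 !scale1r.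
by case: s; rewrite /TE !dd //= addrC.
Qed.
Let TH2E s : TH2 * TE s - TE s * TH2 = spec1 (pm s 2%:R)%:P * TE s.
Proof.
rewrite spec1_polyC -mulmxE mul_scalar_mx mulmxE /TH2 mulrBl mulrBr.
case: s; rewrite /= ?polyCN ?rmorphN /= ?rmorph_nat ?scaleNr scaler_nat mulr2n;
  rewrite /TE !dd /= ?sub0r ?subr0 ?opprD ?opprK //.
Qed.
Let Zl (c : ratf) (P Q : 'M[ratf]_2) : (c *: P) * Q = c *: (P * Q).
Proof. by rewrite -!mulmxE scalemxAl. Qed.
Let Zr (c : ratf) (P Q : 'M[ratf]_2) : P * (c *: Q) = c *: (P * Q).
Proof. by rewrite -!mulmxE scalemxAr. Qed.

Lemma T_rel x y : yangian_rel x y ->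
  evale spec1 (T_gen z) x = evale spec1 (T_gen z) y.
Proof.
have TG s : (if s then delta_mx 0 1 else delta_mx 1 0) = TE s by [].
case=> [|s|s|s|g|g|s|s|s||{}x {}y Sxy]; last exact: (serre_T Sc z Sxy).
all: rewrite [LHS]/= [RHS]/= ?rmorphN1 ?rmorph0 ?mulN1r ?TG -/TH2.
- exact: (TEN true).
- by rewrite Zl Zr -scalerDr TEN scalemx1.
- exact: TEE.
- by rewrite Zl Zr TEE scaler0 addr0.
- by rewrite -!mulmxE scalar_mxC subrr.
- by rewrite -!mulmxE scalar_mxC subrr.
- exact: TH2E.
- by rewrite !Zl !Zr -scalerBr TH2E.
- by rewrite !Zl !Zr -scalerBr TH2E.
- by rewrite Zl Zr subrr.
Qed.
Let TC c g : spec1 c * T_gen z g = T_gen z g * spec1 c.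
Proof. by rewrite -!mulmxE /spec1 /= scalar_mxC. Qed.

Lemma T_Y g : T z (Y g) = T_gen z g. Proof. exact: (lift_gen TC T_rel). Qed.
Lemma T_cst c : T z (cst _ c) = spec1 c. Proof. exact: (lift_cst TC T_rel). Qed.
Lemma TD : {morph T z : x y / x + y}. Proof. exact: (liftD TC T_rel). Qed.
Lemma TM : {morph T z : x y / x * y}. Proof. exact: (liftM TC T_rel). Qed.

Lemma T_eps_rel x y : tensor_rel x y ->
  evale spec1 (T_eps_gen z) x = evale spec1 (T_eps_gen z) y.
Proof.
have evl e : evale spec1 (T_eps_gen z) (map_expr inl e) =
    evale spec1 (T_gen z) e by elim: e => //= ? -> ? ->.
have evr e : evale spec1 (T_eps_gen z) (map_expr inr e) =
    spec1 (evale (idfun : {rmorphism A -> A}) eps_gen e).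
  by elim: e => //= ? -> ? ->; rewrite ?rmorphD ?rmorphM.
case=> [{}x {}y xy|{}x {}y xy|g h]; rewrite ?evl ?evr.
- exact: T_rel.
- by rewrite (eps_rel xy).
- by rewrite /= /eps_gen rmorph0 mul0r !mulr0.
Qed.
Let TeC c g : spec1 c * T_eps_gen z g = T_eps_gen z g * spec1 c.
Proof. by rewrite -!mulmxE /spec1 /= scalar_mxC. Qed.

Lemma T_epsD : {morph T_eps z : x y / x + y}.
Proof. exact: (liftD TeC T_eps_rel). Qed.
Lemma T_epsM : {morph T_eps z : x y / x * y}.
Proof. exact: (liftM TeC T_eps_rel). Qed.
Lemma T_eps_cst c : T_eps z (tcst c) = spec1 c.
Proof. exact: (lift_cst TeC T_eps_rel). Qed.
Lemma T_eps_gl g : T_eps z (gl g) = T_gen z g.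
Proof. exact: (lift_gen TeC T_eps_rel). Qed.
Lemma T_eps_gr g : T_eps z (gr g) = 0.
Proof. by rewrite /T_eps (lift_gen TeC T_eps_rel) /= rmorph0. Qed.

Lemma T_eps_tens x y : T_eps z (x ⊗ y) = T z x * spec1 (eps y).
Proof.
rewrite T_epsM; congr (_ * _).
  elim/presented_ind: x => [g|c|a b Ha Hb|a b Ha Hb].
  - by rewrite tl_gen T_eps_gl T_Y.
  - by rewrite tl_cst T_eps_cst T_cst.
  - by rewrite tlD T_epsD Ha Hb TD.
  - by rewrite tlM T_epsM Ha Hb TM.
elim/presented_ind: y => [g|c|a b Ha Hb|a b Ha Hb].
- by rewrite tr_gen T_eps_gr eps_Y rmorph0.
- by rewrite tr_cst T_eps_cst eps_cst.
- by rewrite trD T_epsD Ha Hb epsD rmorphD.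
- by rewrite trM T_epsM Ha Hb epsM rmorphM.
Qed.

Section Coideal.
Variable t : F.
Let B := twisted_yangian t.
Let M := tens_span (fun _ => True) B.

Let BM b b' : B b -> B b' -> B (b * b'). Proof. exact: sub_mul. Qed.
Let BH : B (Y H). Proof. by apply: sub_gen; apply: Or31. Qed.
Let BH2 : B (Y H2). Proof. by apply: sub_gen; apply: Or32. Qed.
Let BE s : B (Et t s). Proof. by apply: sub_gen; apply: Or33; exists s. Qed.
Let B1 : B 1. Proof. by rewrite -(rmorph1 (cst _)); apply: sub_cst. Qed.

Let tl_M x m : M m -> M (tl x * m).
Proof.
elim=> [y b _ Bb|m1 m2 _ H1 _ H2].
  by rewrite /tens mulrA -tlM; apply: span_tens.
by rewrite mulrDr; apply: span_add.
Qed.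

Let tl_even h : odd_gen h = false -> forall y, gr h * tl y = tl y * gr h.
Proof.
move=> oh; elim/presented_ind => [g|c|a b Ha Hb|a b Ha Hb].
- by rewrite tl_gen gr_gl oh andbF mul1r.
- by rewrite tl_cst cst_central.
- by rewrite tlD mulrDr mulrDl Ha Hb.
- by rewrite tlM mulrA Ha -mulrA Hb mulrA.
Qed.

Let tl_odd y : exists y', forall h, odd_gen h -> gr h * tl y = tl y' * gr h.
Proof.
elim/presented_ind: y => [g|c|a b [a' Ha] [b' Hb]|a b [a' Ha] [b' Hb]].
- exists (cst _ ((-1) ^+ odd_gen g) * Y g) => h oh.
  by rewrite tlM tl_cst !tl_gen gr_gl oh andbT rmorphXn rmorphN1 mulrA.
- by exists (cst _ c) => h _; rewrite tl_cst cst_central.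
- by exists (a' + b') => h oh; rewrite !tlD mulrDr mulrDl Ha // Hb.
- by exists (a' * b') => h oh; rewrite !tlM mulrA Ha // -mulrA Hb // mulrA.
Qed.

Let tr_even_M h m : odd_gen h = false -> B (Y h) -> M m -> M (gr h * m).
Proof.
move=> oh Bh; elim=> [y b _ Bb|m1 m2 _ H1 _ H2].
  rewrite /tens mulrA tl_even // -mulrA -tr_gen -trM.
  by apply: span_tens => //; exact: BM.
by rewrite mulrDr; apply: span_add.
Qed.

Let tr_Et s : tr (Et t s) = gr (Eh s) + tcst (pm s t *: 'X) * gr (E s)
  - tcst (pm s 2%:R^-1 *: 'X) * (gr H * gr (E s)).
Proof.
rewrite /Et -mulN1r -(rmorphN1 (cst _)) !(trD, trM, tr_cst, tr_gen).
by rewrite rmorphN1 mulN1r.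
Qed.

Let tr_Et_M s m : M m -> M (tr (Et t s) * m).
Proof.
elim=> [y b _ Bb|m1 m2 _ H1 _ H2]; last by rewrite mulrDr; apply: span_add.
have [y' Hy'] := tl_odd y.
have -> : tr (Et t s) * (y ⊗ b) = y' ⊗ (Et t s * b).
  rewrite /tens trM !mulrA; congr (_ * _).
  rewrite tr_Et !mulrBl !mulrDl !mulrBr !mulrDr -!mulrA !Hy' //.
  by rewrite ![tl y' * (tcst _ * _)]mulrA -!cst_central -!mulrA
    [gr H * (tl y' * _)]mulrA tl_even // -!mulrA.
by apply: span_tens => //; exact: BM.
Qed.

Let Delta_Et s : Delta (Et t s) =
  tl (Et t s) + tr (Et t s) - tcst (pm s 1 *: 'X) * (gl (E s) * gr H).
Proof.
have tlE : tl (Et t s) = gl (Eh s) + tcst (pm s t *: 'X) * gl (E s)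
    - tcst (pm s 2%:R^-1 *: 'X) * (gl H * gl (E s)).
  rewrite /Et -mulN1r -(rmorphN1 (cst _)) !(tlD, tlM, tl_cst, tl_gen).
  by rewrite rmorphN1 mulN1r.
have hE : gr H * gl (E s) = gl (E s) * gr H.
  by rewrite gr_gl andbF mul1r.
have -> : pm s 1 *: 'X = pm s 2%:R^-1 *: 'X + pm s 2%:R^-1 *: 'X :> A.
  rewrite -scalerDl; congr (_ *: _).
  have h : 2%:R^-1 + 2%:R^-1 = 1 :> F.
    by rewrite -mulr2n -[_ *+ 2]mulr_natl mulfV // pnatr_eq0.
  by case: s {tlE hE}; rewrite /= -?opprD h.
rewrite tlE tr_Et {1}/Et -mulN1r -(rmorphN1 (cst _)).
rewrite !(DeltaD, DeltaM, Delta_cst, Delta_Y) rmorphN1 mulN1r.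
rewrite [Delta_gen (Eh s)]/Delta_gen [Delta_gen (E s)]/= [Delta_gen H]/=.
rewrite !tensg1 !tens1g !tens_gen.
set c1 := tcst (pm s t *: 'X); set c2 := tcst (pm s 2%:R^-1 *: 'X).
rewrite [(gl H + gr H) * _]mulrDl !mulrDr hE (rmorphD tcst) -/c2.
rewrite [(c2 + c2) * _]mulrDl mulrN !opprD !opprK !addrA.
rewrite [LHS](ACl (1*5*7*2*6*10*3*9*(4*8))%AC)/= subrr addr0.
by [].
Qed.

(* Delta(B) is contained in Y (x) B. *)
Lemma twisted_yangian_coideal b : B b -> M (Delta b).
Proof.
move=> Bb.
have MD m1 m2 : M m1 -> M m2 -> M (m1 + m2) by apply: span_add.
have Mc c m : M m -> M (tcst c * m) by rewrite -tl_cst; apply: tl_M.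
have MN m : M m -> M (- m).
  by rewrite -mulN1r -(rmorphN1 tcst); apply: Mc.
have D0 : forall m, M m -> M (Delta b * m); last first.
  rewrite -(mulr1 (Delta b)); apply: D0.
  by have -> : 1 = 1 ⊗ 1 :> tensor2; [rewrite /tens tl1 tr1 mulr1|apply: span_tens].
elim: Bb => [{}b Gb|c|x y _ Hx _ Hy|x y _ Hx _ Hy] m Mm.
- have prim h : odd_gen h = false -> Delta_gen h = gl h + gr h -> B (Y h) -> 
      M (Delta (Y h) * m).
    move=> oh Dh Bh; rewrite Delta_Y Dh mulrDl; apply: MD.
      by rewrite -tl_gen; apply: tl_M.
    exact: tr_even_M.
  case: Gb => [->|->|[s ->]].
  + by apply: prim => //=; rewrite tensg1 tens1g.
  + by apply: prim => //=; rewrite tensg1 tens1g.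
  + rewrite Delta_Et !mulrDl mulNr -!mulrA; apply: (MD); [apply: (MD)|].
    * exact: tl_M.
    * exact: tr_Et_M.
    * by apply/MN/Mc; rewrite -tl_gen; apply/tl_M/tr_even_M.
- by rewrite Delta_cst; apply: Mc.
- by rewrite DeltaD mulrDl; apply: MD; [exact: Hx|exact: Hy].
- by rewrite DeltaM -mulrA; apply/Hx/Hy.
Qed.
End Coideal.

End Compatible.

End Relations.

Lemma serre_compatible_none : serre_compatible (fun _ _ => False).
Proof. by split. Qed.

End Yangian.

Section Reflection.
Variable F : numFieldType.

Local Notation "x %:F" := (@FracField.tofrac _ x).

(* F(u, v), with u the inner and v the outer variable. *)
Definition ratf2 := {fraction {poly {poly F}}}.
Definition const2 (c : F) : ratf2 := c%:P%:P%:F.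
Definition uvar : ratf2 := ('X%:P)%:F.
Definition vvar : ratf2 := 'X%:F.

Definition poly_at (z : ratf2) (p : {poly F}) : ratf2 := (map_poly const2 p).[z].

(* Substitution u |-> z in a rational function of u; a field morphism when z  *)
(* is transcendental over F, see [ratf_at_div].                               *)
Definition ratf_at (z : ratf2) (f : ratf F) : ratf2 :=
  poly_at z \n_(repr f) / poly_at z \d_(repr f).

HB.instance Definition _ := GRing.RMorphism.copy const2
  (@FracField.tofrac {poly {poly F}} \o polyC \o polyC).

Lemma frac_numden (f : ratf F) : f = (\n_(repr f))%:F / (\d_(repr f))%:F.
Proof.
have d0 := denom_ratioP (repr f).
apply: (canRL (mulfK _)); first by rewrite tofrac_eq0.
rewrite -{1}[f]reprK !piE.
apply/eqmodP; rewrite /= /FracField.mulf /FracField.equivf /=.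
by rewrite !numden_Ratio ?mulr1 ?oner_neq0 // mulrC.
Qed.

Lemma ratf_at_div z p q : (forall d, d != 0 -> poly_at z d != 0) -> q != 0 ->
  ratf_at z (p%:F / q%:F) = poly_at z p / poly_at z q.
Proof.
move=> zT q0; set f : ratf F := _ / _.
have d0 := denom_ratioP (repr f).
have : (\n_(repr f) * q)%:F = (p * \d_(repr f))%:F.
  apply/eqP; rewrite !rmorphM /= -eqr_div ?tofrac_eq0 // -frac_numden.
  by [].
move/eqP; rewrite tofrac_eq => /eqP/(congr1 (poly_at z)).
rewrite /poly_at !rmorphM !hornerM => e.
by apply/eqP; rewrite /ratf_at eqr_div ?zT // e.
Qed.

Lemma uvar_transcendental d : d != 0 -> poly_at uvar d != 0.
Proof.
have -> : poly_at uvar d = (d%:P)%:F.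
  rewrite /poly_at (map_poly_comp (@tofrac {poly {poly F}})) horner_map /=; congr (_%:F).
  rewrite (map_poly_comp (@polyC _)) horner_map /=; congr (_%:P).
  exact: comp_polyXr.
by rewrite tofrac_eq0 polyC_eq0.
Qed.

Lemma vvar_transcendental d : d != 0 -> poly_at vvar d != 0.
Proof.
have -> : poly_at vvar d = (d^:P)%:F.
  rewrite /poly_at (map_poly_comp (@tofrac {poly {poly F}})) horner_map /=; congr (_%:F).
  rewrite (map_poly_comp (@polyC _)).
  exact: comp_polyXr.
by rewrite tofrac_eq0 map_polyC_eq0.
Qed.

Definition Rmx (z : ratf2) : 'M[ratf2]_(2 * 2) :=
  let r := z / (z + 1) in
  let rows := [:: [:: 1; 0    ; 0    ; 0           ];
                  [:: 0; r    ; 1 - r; 0           ];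
                  [:: 0; 1 - r; r    ; 0           ];
                  [:: 0; 0    ; 0    ; - 1 + 2%:R * r]] in
  \matrix_(i, j) (nth [::] rows i)`_j.

(* Graded tensor product of operators on C^(1|1), with the sign                *)
(* (P (x) Q)(v (x) w) = (-1)^(|Q| |v|) P v (x) Q w; index 0 is even, 1 is odd, *)
(* and the basis of the tensor square is in lexicographic order.              *)
Definition gtensmx (P Q : 'M[ratf2]_2) : 'M[ratf2]_(2 * 2) :=
  \matrix_(i, j)
    let: (i1, i2) := mxtens_unindex i in
    let: (j1, j2) := mxtens_unindex j in
    (-1) ^+ ((i2 + j2) * j1) * P i1 j1 * Q i2 j2.

Definition reflection_equation (K : 'M[ratf F]_2) : Prop :=
  let K1 := gtensmx (map_mx (ratf_at uvar) K) 1%:M in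
  let K2 := gtensmx 1%:M (map_mx (ratf_at vvar) K) in
  Rmx (uvar - vvar) *m K1 *m Rmx (uvar + vvar) *m K2 =
  K2 *m Rmx (uvar + vvar) *m K1 *m Rmx (uvar - vvar).

End Reflection.

(* Main.v *)
(* By the counit axiom the intertwining equation reads                        *)
(* T_(-u)(b) K = K T_u(b).  For b = H_2 it forces K to be diagonal, and for   *)
(* the two twisted generators, whose images are (u + g) e_(1,2) and           *)
(* (u - g) e_(2,1) with g = t - 1/2, it reduces to the single condition       *)
(* (g - u) k_2 = (g + u) k_1.  Hence K = diag(g - u, g + u) up to a scalar,   *)
(* and the reflection equation is a rational identity.                        *)

Require Import Defs.
From HB Require Import structures.
From mathcomp Require Import all_boot all_order all_algebra.
From mathcomp Require Import reals complex mxtens.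
From mathcomp Require Import ring.
Import GRing.Theory Num.Theory.
Local Open Scope ring_scope.

(** The elements satisfying the intertwining equation for a fixed K form a subalgebra, so only the
    generators matter; there the equation says that K is diagonal with one linear relation between
    its two entries ([T_eps_Delta], [intertwinesP]), whose solutions form the line spanned by
    [singletK]. For diagonal K the graded signs disappear ([gtensmx_diag]) and the reflection
    equation is checked entry by entry ([reflection_diag]). As r(x) = x/(x+1) and 1 - r(x) =
    1/(x+1), both sides of the one nontrivial entry equal 2u(g^2 - v^2)/((u-v+1)(u+v+1)). *)

Lemma ord2W (P : 'I_2 -> Prop) : P 0 -> P 1 -> forall i, P i.
Proof.
move=> P0 P1 [[|[|//]] i2].
  by rewrite (_ : Ordinal i2 = 0); last exact: val_inj.
by rewrite (_ : Ordinal i2 = 1); last exact: val_inj.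
Qed.

Lemma mulmx2E (S : comNzRingType) (P Q : 'M[S]_2) i j :
  (P *m Q) i j = P i 0 * Q 0 j + P i 1 * Q 1 j.
Proof.
rewrite mxE big_ord_recl big_ord1.
by rewrite (_ : lift ord0 ord0 = 1); last exact: val_inj.
Qed.

(* Up to exchanging the two sides, the only entry of the reflection equation  *)
(* that is not a polynomial identity in a, b, u, v and g.                     *)
Lemma reflection_entry (L : fieldType) (u v g : L) :
  u - v + 1 != 0 -> u + v + 1 != 0 ->
  let a := (u - v) / (u - v + 1) in let b := (u + v) / (u + v + 1) in
  (a * (g - u) * (1 - b) + (1 - a) * (g + u) * b) * (g - v) =
  (g + v) * (b * (g - u) * (1 - a) + (1 - b) * (g + u) * a).
Proof. by move=> um up /=; field; rewrite um up. Qed.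

(** With K_1 and K_2 diagonal, an entry of either side is a four-term sum over the middle index,
    weighted by K_1 and multiplied by a single entry of K_2. *)
Lemma reflection_diag (L : fieldType) (u v g : L) :
  u - v + 1 != 0 -> u + v + 1 != 0 ->
  let R z : 'M[L]_(2 * 2) := \matrix_(i, j) (nth [::]
    [:: [:: 1; 0; 0; 0];
        [:: 0; z / (z + 1); 1 - z / (z + 1); 0];
        [:: 0; 1 - z / (z + 1); z / (z + 1); 0];
        [:: 0; 0; 0; - 1 + 2%:R * (z / (z + 1))]] i)`_j in
  let k x : 'rV[L]_2 := \row_j if j == 0 then g - x else g + x in
  let tensr (p q : 'rV[L]_2) : 'rV[L]_(2 * 2) :=
    \row_i (p 0 (mxtens_unindex i).1 * q 0 (mxtens_unindex i).2) in
  let K1 := diag_mx (tensr (k u) (const_mx 1)) in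
  let K2 := diag_mx (tensr (const_mx 1) (k v)) in
  R (u - v) *m K1 *m R (u + v) *m K2 = K2 *m R (u + v) *m K1 *m R (u - v).
Proof.
move=> um up R k tensr K1 K2.
apply/matrixP => i j.
have sandwich (P Q : 'M[L]_(2 * 2)) d :
    (P *m diag_mx d *m Q) i j = \sum_l P i l * d 0 l * Q l j.
  by rewrite mxE; apply: eq_bigr => l _; rewrite mul_mx_diag mxE.
have diag_r (P : 'M[L]_(2 * 2)) d : (P *m diag_mx d) i j = P i j * d 0 j.
  by rewrite mul_mx_diag mxE.
have diag_l (P : 'M[L]_(2 * 2)) d : (diag_mx d *m P) i j = d 0 i * P i j.
  by rewrite mul_diag_mx mxE.
rewrite diag_r -[in RHS]mulmxA -[in RHS]mulmxA diag_l [in RHS]mulmxA.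
rewrite !sandwich {sandwich diag_r diag_l} !big_ord_recl !big_ord0 !mxE.
have /= := reflection_entry _ _ _ g um up.
(* The two values of r become indeterminates; only the off-diagonal entries of the middle block then
   need [key]. *)
move: ((u - v) / _) ((u + v) / _) => a b key.
case: i j => [[|[|[|[|//]]]] i4] [[|[|[|[|//]]]] j4] /=.
all: rewrite !(mulr0, mul0r, mulr1, mul1r, addr0, add0r).
all: try ring.
  exact: key.
by apply: etrans (etrans (esym key) _); ring.
Qed.

Section SingletBoundary.
Variable F : numFieldType.
Local Notation "x %:F" := (@FracField.tofrac _ x).

Definition scal (c : F) : ratf F := c%:P%:F.

Lemma spec1X (c : F) : spec1 (c *: 'X) = (scal c)%:M.
Proof. by rewrite /spec1 /= /horner_eval hornerZ hornerX mulr1. Qed.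

HB.instance Definition _ := GRing.RMorphism.copy scal
  (@FracField.tofrac {poly F} \o polyC).

Lemma scal_pm s (c : F) : scal (pm s c) = if s then scal c else - scal c.
Proof. by case: s => //=; rewrite rmorphN. Qed.

(** Used on the off-diagonal entries of K, which H_2 equates with their opposites. *)
Lemma ratf_opp_eq0 (x : ratf F) : x = - x -> x = 0.
Proof.
have two0 : (1 + 1 : ratf F) != 0.
  have -> : 1 + 1 = scal (1 + 1) by rewrite rmorphD rmorph1.
  by rewrite /scal tofrac_eq0 polyC_eq0 (pnatr_eq0 _ 2).
by move=> e; apply: (mulfI two0); rewrite mulr0 mulrDl mul1r {1}e addNr.
Qed.

Section Intertwiner.
Variable serre : yexpr F -> yexpr F -> Prop.
Hypothesis serreP : serre_compatible serre.
Variable t : F.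

(** Every correction term of the coproduct has a generator as its second factor, and the counit
    kills it. Multiplicativity extends this from generators to all [b]. *)
Lemma T_eps_Delta z (b : yangian serre) : T_eps z (Delta b) = T z b.
Proof.
have T1 : T z (1 : yangian serre) = 1.
  by rewrite -(rmorph1 (cst _)) (T_cst serreP) rmorph1.
have eps1 : eps (1 : yangian serre) = 1.
  by rewrite -(rmorph1 (cst _)) (eps_cst serreP).
have TepsN a : T_eps z (- a : tensor2 serre) = - T_eps z a.
  rewrite -mulN1r -(rmorphN1 (cst _)) (T_epsM serreP) (T_eps_cst serreP).
  by rewrite rmorphN1 mulN1r.
elim/presented_ind: b => [g|c|x y Hx Hy|x y Hx Hy].
- rewrite -/(Y serre g) (Delta_Y serreP).
  have prim h : T_eps z (tens (Y serre h) 1 + tens 1 (Y serre h)) = T z (Y serre h).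
    rewrite (T_epsD serreP) !(T_eps_tens serreP) eps1 (eps_Y serreP).
    by rewrite rmorph1 rmorph0 mulr1 mulr0 addr0.
  case: g => [s|||s||]; rewrite /Delta_gen ?prim //.
  + rewrite (T_epsD serreP) prim TepsN (T_epsM serreP) (T_epsD serreP) TepsN.
    rewrite !(T_eps_tens serreP) !(eps_Y serreP) rmorph0 !mulr0.
    by rewrite !subr0 mulr0 subr0.
  + rewrite (T_epsD serreP) prim TepsN (T_epsM serreP) (T_epsD serreP).
    rewrite !(T_eps_tens serreP) !(eps_Y serreP) rmorph0 !mulr0.
    by rewrite addr0 mulr0 subr0.
- rewrite (Delta_cst serreP).
  exact: etrans (T_eps_cst serreP z c) (esym (T_cst serreP z c)).
- by rewrite (DeltaD serreP) (T_epsD serreP) Hx Hy (TD serreP).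
- by rewrite (DeltaM serreP) (T_epsM serreP) Hx Hy (TM serreP).
Qed.

(** The 1/2 comes from the quadratic term of the twisted generators, in which H acts as the
    identity. *)
Let g : ratf F := scal (t - 2%:R^-1).

Lemma T_Et z s : T z (Et serre t s) = (z + (if s then g else - g)) *: T_gen z (E s).
Proof.
rewrite /Et -mulN1r -(rmorphN1 (cst _)).
rewrite !(TD serreP, TM serreP, T_cst serreP, T_Y serreP) rmorphN1 mulN1r.
rewrite !spec1X !scal_pm [T_gen z H]/= mul1r -!mulmxE !mul_scalar_mx.
rewrite /= -!scaleNr -!scalerDl; congr (_ *: _).
by case: s; rewrite /g rmorphB; ring.
Qed.

Lemma intertwinesP (K : 'M[ratf F]_2) :
  intertwines serre t K <->
  [/\ K 0 1 = 0, K 1 0 = 0 & (g - upar F) * K 1 1 = (g + upar F) * K 0 0].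
Proof.
set u := upar F.
have TH2 z : T z (Y serre H2) = delta_mx 0 0 - delta_mx 1 1 by rewrite (T_Y serreP).
split=> [KT|[K01 K10 K11]].
  have B i j x :
      [\/ x = Y serre H, x = Y serre H2 | exists s, x = Et serre t s] ->
      (T (- u) x *m K) i j = (K *m T u x) i j.
    by move=> Gx; rewrite -!T_eps_Delta KT //; apply: sub_gen.
  have BH2 i j := B i j _ (Or32 _ _ (erefl _)).
  (* The [false] generator would give the same scalar relation up to sign. *)
  have BE i j := B i j _ (Or33 _ _ (ex_intro _ true (erefl _))).
  pose simp := (subr0, sub0r, subrr, mulr0, mul0r, mulr1, mul1r, mulrN1, mulN1r,
    addr0, add0r).
  split.
  - by move: (BH2 0 1); rewrite !TH2 !mulmx2E !mxE /= !simp => e;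
      apply: ratf_opp_eq0.
  - by move: (BH2 1 0); rewrite !TH2 !mulmx2E !mxE /= !simp => e;
      apply: ratf_opp_eq0.
  - move: (BE 0 1); rewrite !T_Et !mulmx2E !mxE /= !simp => e.
    by rewrite addrC e mulrC addrC.
move=> b Bb; rewrite !T_eps_Delta.
elim: Bb => {b} [b Gb|c|x y _ Hx _ Hy|x y _ Hx _ Hy].
- case: Gb => [->|->|[s ->]].
  + by rewrite !(T_Y serreP) /= mul1mx mulmx1.
  + rewrite !TH2; apply/matrixP; apply: ord2W; apply: ord2W;
      by rewrite !mulmx2E !mxE /= ?K01 ?K10; ring.
  + rewrite !T_Et; apply/matrixP; case: s; apply: ord2W; apply: ord2W;
      rewrite !mulmx2E !mxE /= ?K01 ?K10 -/u; try ring.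
      by transitivity ((g - u) * K 1 1); [|rewrite K11]; ring.
    by transitivity (- ((g + u) * K 0 0)); [|rewrite -K11]; ring.
- by rewrite !(T_cst serreP) /spec1 /= scalar_mxC.
- by rewrite !(TD serreP) mulmxDl mulmxDr Hx Hy.
- by rewrite !(TM serreP) -!mulmxE -mulmxA Hy !mulmxA Hx.
Qed.
End Intertwiner.

Definition singletK (c : F) : 'M[ratf F]_2 :=
  diag_mx (\row_j if j == 0 then scal c - upar F else scal c + upar F).

Lemma poly_atE z (c s : F) :
  poly_at z (c%:P + s *: 'X) = const2 c + const2 s * z.
Proof.
by rewrite /poly_at rmorphD /= map_polyC map_polyZ map_polyX !hornerE.
Qed.

(** Transcendence of [z] makes the value independent of the representative chosen in [ratf_at]. *)
Lemma ratf_at_poly z (p : {poly F}) :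
  (forall d, d != 0 -> poly_at z d != 0) -> ratf_at z (p%:F) = poly_at z p.
Proof.
move=> zT; rewrite -[p%:F]divr1 -(rmorph1 (@FracField.tofrac {poly F})).
by rewrite ratf_at_div ?oner_neq0 // /poly_at rmorph1 hornerC divr1.
Qed.

Lemma map_singletK z c : (forall d, d != 0 -> poly_at z d != 0) ->
  map_mx (ratf_at z) (singletK c) =
  diag_mx (\row_j if j == 0 then const2 c - z else const2 c + z).
Proof.
move=> zT.
have at0 : ratf_at z 0 = 0.
  rewrite -(rmorph0 (@FracField.tofrac {poly F})) ratf_at_poly //.
  by rewrite /poly_at rmorph0 horner0.
(* The two diagonal entries are the cases s = -1 and s = 1. *)
have atD s : ratf_at z (scal c + scal s * upar F) = const2 c + const2 s * z.
  by rewrite -poly_atE -ratf_at_poly // rmorphD /= -mul_polyC rmorphM.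
apply/matrixP; apply: ord2W; apply: ord2W; rewrite !mxE /= ?at0 //.
  by have := atD (-1); rewrite !rmorphN1 !mulN1r.
by have := atD 1; rewrite !rmorph1 !mul1r.
Qed.

(** Diagonal operators are even: on the diagonal the sign exponent is 2 i2 i1. *)
Lemma gtensmx_diag (p q : 'rV[ratf2 F]_2) :
  gtensmx (diag_mx p) (diag_mx q) =
  diag_mx (\row_i (p 0 (mxtens_unindex i).1 * q 0 (mxtens_unindex i).2)).
Proof.
apply/matrixP => i j; rewrite !mxE.
rewrite -[i == j](inj_eq (can_inj (@mxtens_unindexK _ _))).
case: (mxtens_unindex i) (mxtens_unindex j) => i1 i2 [j1 j2] /=.
rewrite !mxE xpair_eqE.
have [->|_] := eqVneq i1 j1; last by rewrite mulr0 mul0r.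
have [->|_] := eqVneq i2 j2; last by rewrite mulr0.
by rewrite addnn -mul2n -mulnA exprM sqrrN expr1n expr1n mul1r.
Qed.

Lemma reflection_singletK c : reflection_equation (singletK c).
Proof.
rewrite /reflection_equation.
rewrite (map_singletK _ _ (@uvar_transcendental F)).
rewrite (map_singletK _ _ (@vvar_transcendental F)).
set u := uvar F; set v := vvar F; set g := const2 c.
(* As a polynomial in the outer variable v over F[u], this is the opposite of the monic v - (u +
   1). *)
have um : u - v + 1 != 0.
  rewrite /u /v /uvar /vvar -(rmorph1 (@FracField.tofrac {poly {poly F}})).
  rewrite -rmorphB -rmorphD tofrac_eq0 addrAC -[1]polyC1 -polyCD -opprB oppr_eq0.
  by rewrite polyXsubC_eq0.
have up : u + v + 1 != 0.
  rewrite /u /v /uvar /vvar -(rmorph1 (@FracField.tofrac {poly {poly F}})).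
  rewrite -!rmorphD tofrac_eq0 addrAC -[1]polyC1 -polyCD addrC.
  by rewrite -[_%:P]opprK -polyCN polyXsubC_eq0.
rewrite -[1%:M]diag_const_mx !gtensmx_diag.
exact: reflection_diag um up.
Qed.

Lemma intertwines_singletK serre (serreP : serre_compatible serre) t :
  intertwines serre t (singletK (t - 2%:R^-1)).
Proof.
by apply/(intertwinesP _ serreP); rewrite !mxE /= mulr0n mulr1n; split=> //; ring.
Qed.

End SingletBoundary.

Theorem proposition5p3 (R : realType) (t : R[i])
    (serre : yexpr R[i] -> yexpr R[i] -> Prop)
    (serreP : serre_compatible serre) :
  exists K : 'M[ratf R[i]]_2,
    [/\ K != 0,
        intertwines serre t K,
        forall K' : 'M[ratf R[i]]_2, intertwines serre t K' ->
          exists c : ratf R[i], K' = c *: K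
      & reflection_equation K].
Proof.
set g := t - 2%:R^-1.
have k0 : scal _ g - upar _ != 0.
  rewrite /scal /upar -rmorphB tofrac_eq0 -opprB oppr_eq0.
  by rewrite polyXsubC_eq0.
exists (singletK _ g); split.
- by apply: contra_neq k0 => /matrixP/(_ 0 0); rewrite !mxE.
- exact: intertwines_singletK.
- move=> K' /(intertwinesP _ _ serreP)[K01 K10 K11].
  (* The factor is forced by the (0,0) entries; the (1,1) entries then agree by cancelling g - u in
     the linear relation. *)
  exists (K' 0 0 / (scal _ g - upar _)).
  apply/matrixP; apply: ord2W; apply: ord2W; rewrite !mxE /= ?mulr0 //.
    by rewrite mulr1n divfK.
  by apply: (mulfI k0); rewrite K11 mulr1n mulrA [_ * (_ / _)]mulrC divfK // mulrC.
- exact: reflection_singletK.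
Qed.
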